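(* Let $\mathcal{Y}$ be a separable real Hilbert space, let $d\geq1$, $m\in\mathbb{N}$, and let $\mathcal{X}=[0,1]^d$. Let $B\subset\mathcal{Y}$ satisfy $N(\epsilon,B,\lVert\cdot\rVert_{\mathcal{Y}})\leq\exp\{M\epsilon^{-\tau_{\exp}}\}$ for all $\epsilon>0$, for some constants $M,\tau_{\exp}>0$, and let $K_B>0$ be such that $\lVert y\rVert_{\mathcal{Y}}\le K_B$ for all $y\in B$. Then there exist $\delta_0>0$ and a constant $K$ depending only on $K_B$, $m$, $d$, $M$ and $\tau_{\exp}$ such that for all $0<\delta<\delta_0$, \[H\left(\delta,\mathcal{G}^m_B,\lVert\cdot\rVert_\infty\right)\leq K\delta^{-\left(\frac{d}{m}+\tau_{\exp}\right)}.\]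
   Context: For a metric space $(\mathcal{Z},\rho)$ and $\delta>0$, $N(\delta,\mathcal{Z},\rho)$ is the minimal number of closed $\rho$-balls of radius $\delta$ with centres in $\mathcal{Z}$ needed to cover $\mathcal{Z}$, and $H(\delta,\mathcal{Z},\rho)=\log N(\delta,\mathcal{Z},\rho)$. For $p\in\mathbb{N}_0^d$ write $[p]=p_1+\dots+p_d$ and $D^pg=\partial_1^{p_1}\cdots\partial_d^{p_d}g$, with $D^0g=g$. $\mathcal{G}^m_B$ is the set of $m$-times differentiable functions $g:\mathcal{X}\to\mathcal{Y}$ whose partial derivatives $D^pg$ of orders $[p]\leq m$ exist everywhere on the interior of $\mathcal{X}$ and satisfy $D^pg(x)\in B$ for all $x\in\mathcal{X}$ and all $[p]\leq m$. $\lVert g\rVert_\infty=\sup_{x\in\mathcal{X}}\lVert g(x)\rVert_{\mathcal{Y}}$. *)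

(* Defs.v *)
From Stdlib Require List.
From HB Require Import structures.
From mathcomp Require Import all_boot all_order all_algebra.
From mathcomp Require Import all_classical all_reals all_analysis.
Set Implicit Arguments. Unset Strict Implicit. Unset Printing Implicit Defensive.
Import Order.TTheory GRing.Theory Num.Theory.
Import numFieldNormedType.Exports.
Local Open Scope classical_set_scope.
Local Open Scope ring_scope.

(* Separable real Hilbert space: a complete normed space whose norm satisfies
   the parallelogram law (i.e. comes from an inner product), with a countable
   dense subset. *)
Definition parallelogram_law {R : realType} (Y : normedModType R) : Prop :=
  forall x y : Y,
    `|x + y| ^+ 2 + `|x - y| ^+ 2 = 2 * `|x| ^+ 2 + 2 * `|y| ^+ 2.

Definition separable_space (T : topologicalType) : Prop :=
  exists D : set T, countable D /\ dense D.

(* Covering number N(delta, Z, rho): minimal number of closed rho-balls of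
   radius delta with centres in Z covering Z (+oo if no finite cover). *)
Definition covers {R : realType} {T : Type} (rho : T -> T -> \bar R)
  (Z : set T) (delta : R) (s : seq T) : Prop :=
  (forall c, List.In c s -> Z c) /\
  (forall z, Z z -> exists2 c, List.In c s & (rho z c <= delta%:E)%E).

Definition covering_number {R : realType} {T : Type}
  (rho : T -> T -> \bar R) (Z : set T) (delta : R) : \bar R :=
  ereal_inf [set ((size s)%:R)%:E | s in [set s : seq T | covers rho Z delta s]].

Definition metric_entropy {R : realType} {T : Type}
  (rho : T -> T -> \bar R) (Z : set T) (delta : R) : \bar R :=
  match covering_number rho Z delta with
  | EFin r => if r == 0 then -oo%E else (ln r)%:E
  | +oo%E => +oo%E
  | -oo%E => -oo%E
  end.

Definition norm_dist {R : realType} {Y : normedModType R} (y z : Y) : \bar R :=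
  (`|y - z|)%:E.

Definition cube {R : realType} (d : nat) : set 'rV[R]_d :=
  [set x | forall i : 'I_d, 0 <= x ord0 i <= 1].
Definition cube_int {R : realType} (d : nat) : set 'rV[R]_d :=
  [set x | forall i : 'I_d, 0 < x ord0 i < 1].
Arguments cube {R} d.
Arguments cube_int {R} d.

Definition sup_dist {R : realType} {Y : normedModType R} (d : nat)
  (g h : 'rV[R]_d -> Y) : \bar R :=
  ereal_sup [set (`|g x - h x|)%:E | x in cube d].

Definition partial {R : realType} {Y : normedModType R} {d : nat} (i : 'I_d)
  (f : 'rV[R]_d -> Y) : 'rV[R]_d -> Y :=
  fun x => 'D_(delta_mx 0 i) f x.

Definition Diter {R : realType} {Y : normedModType R} {d : nat}
  (s : seq 'I_d) (f : 'rV[R]_d -> Y) : 'rV[R]_d -> Y :=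
  foldr (@partial R Y d) f s.

Fixpoint Dexists {R : realType} {Y : normedModType R} {d : nat}
  (s : seq 'I_d) (f : 'rV[R]_d -> Y) : Prop :=
  match s with
  | [::] => True
  | i :: s' => Dexists s' f /\
      forall x, cube_int d x -> derivable (Diter s' f) x (delta_mx 0 i)
  end.

Definition mindex_order {d : nat} (p : 'I_d -> nat) : nat := (\sum_(i < d) p i)%N.
Definition mindex_seq {d : nat} (p : 'I_d -> nat) : seq 'I_d :=
  flatten [seq nseq (p i) i | i <- enum 'I_d].
Definition Dmulti {R : realType} {Y : normedModType R} {d : nat}
  (p : 'I_d -> nat) (g : 'rV[R]_d -> Y) : 'rV[R]_d -> Y :=
  Diter (mindex_seq p) g.

Definition Gclass {R : realType} {Y : normedModType R} (d m : nat) (B : set Y)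
  : set ('rV[R]_d -> Y) :=
  [set g | {within cube d, continuous g} /\
     (forall x, cube d x -> B (g x)) /\
     (forall p : 'I_d -> nat, (mindex_order p <= m)%N ->
        Dexists (mindex_seq p) g /\
        forall x, cube_int d x -> B (Dmulti p g x))].
Arguments Gclass {R Y} d m B.
Arguments sup_dist {R Y} d g h.
Arguments covering_number {R T} rho Z delta.
Arguments metric_entropy {R T} rho Z delta.

(* Main.v *)
(* The values of [g] at finitely many grid points determine [g] up to [delta].
   Cut [0,1] into [n ~ delta^(-1/m)] intervals, each carrying [m] interior
   nodes. In one variable, Lagrange interpolation of degree [m - 1] at these
   nodes has uniformly bounded weights and, by Taylor's formula with remainder
   bounded by the [m]-th derivative, error [O(n^-m)]. Interpolating one
   coordinate at a time uses only the pure partial derivatives of order [m], so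
   the order in which mixed partials are taken, and their possible lack of
   continuity, do not matter. Rounding the [(n m)^d] grid values to an
   [O(delta)]-net of [B] costs [O(delta^-tau)] each in entropy, which gives the
   exponent [d / m + tau]. *)
Require Import Defs.
From HB Require Import structures.
From mathcomp Require Import all_boot all_order all_algebra.
From mathcomp Require Import all_classical all_reals all_analysis.
From mathcomp Require Import qpoly ring lra.
Set Implicit Arguments. Unset Strict Implicit. Unset Printing Implicit Defensive.
Import Order.TTheory GRing.Theory Num.Theory.
Import numFieldNormedType.Exports.
Local Open Scope classical_set_scope.
Local Open Scope ring_scope.

(** * Mean value inequality and Taylor expansion for vector-valued functions *)

Lemma derive_local_lipschitz (R : realType) (Y : normedModType R) (f : R -> Y)
    (c K : R) (df : Y) (e : R) :
  is_derive c 1 f df -> `|df| <= K -> 0 < e ->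
  exists2 eta : R, 0 < eta &
    forall t, `|t - c| < eta -> `|f t - f c| <= (K + e) * `|t - c|.
Proof.
move=> [dfc <-] hK e0.
have /cvgrPdist_lt /(_ _ e0) := dfc.
move=> [eta /= eta0 H]; exists eta => // t tc.
have [->|tneq] := eqVneq t c; first by rewrite !subrr !normr0 mulr0.
have tc0 : t - c != 0 by rewrite subr_eq0.
have {H} := H (t - c); rewrite /ball_ /= sub0r normrN => /(_ tc tc0).
rewrite /GRing.scale/= mulr1 subrK => H.
have : `|(t - c)^-1 *: (f t - f c)| <= K + e.
  rewrite -[X in `|X|](subrK ('D_1 f c)) addrC.
  by rewrite (le_trans (ler_normD _ _))// lerD// distrC ltW.
by rewrite normrZ normfV ler_pdivrMl ?normr_gt0// mulrC.
Qed.

(** Vector values rule out an intermediate-point argument. With slack [e] in the slope, the estimate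
    propagates from [a] to [b], and then [e] tends to 0. *)
Lemma mean_value_ineq (R : realType) (Y : normedModType R) (f df : R -> Y)
    (a b K : R) :
  a <= b ->
  (forall x, a <= x <= b -> is_derive x 1 f (df x)) ->
  (forall x, a <= x <= b -> `|df x| <= K) ->
  `|f b - f a| <= K * (b - a).
Proof.
move=> ab dfE dfK.
suff H e : 0 < e -> `|f b - f a| <= (K + e) * (b - a).
  have [->|aneb] := eqVneq a b; first by rewrite !subrr normr0 mulr0.
  have ba : 0 < b - a by rewrite subr_gt0 lt_neqAle aneb.
  rewrite -ler_pdivrMr//; apply/ler_addgt0Pr => e /H.
  by rewrite -ler_pdivrMr.
move=> e0; rewrite leNgt; apply/negP => badb.
(* The local estimate at the infimum of the bad points pushes the good points past it. *)
pose bad := [set t : R | a <= t <= b /\ (K + e) * (t - a) < `|f t - f a|].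
have badP : bad b by rewrite /bad/= ab lexx.
have lba : lbound bad a by move=> t [/andP[]].
have hinf : has_inf bad by split; [exists b|exists a].
pose c := inf bad.
have ac : a <= c by apply: lb_le_inf => //; exists b.
have cb : c <= b by apply: (ge_inf (proj2 hinf)).
have acb : a <= c <= b by rewrite ac.
have good t : a <= t < c -> `|f t - f a| <= (K + e) * (t - a).
  move=> /andP[at_ tc]; rewrite leNgt; apply/negP => bt.
  have : bad t by split=> //; rewrite at_ (le_trans (ltW tc) cb).
  by move/(ge_inf (proj2 hinf)); rewrite leNgt tc.
have Ke : 0 <= K + e.
  by rewrite addr_ge0 ?(ltW e0)// (le_trans (normr_ge0 _) (dfK _ acb)).
have [eta eta0 loc] := derive_local_lipschitz (dfE c acb) (dfK c acb) e0.
have gc : `|f c - f a| <= (K + e) * (c - a).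
  have [->|cna] := eqVneq c a; first by rewrite !subrr normr0 mulr0.
  have ac' : a < c by rewrite lt_neqAle eq_sym cna.
  (* A good point to the left of [c] within [eta]: the local estimate carries its bound over to [c]
     itself. *)
  pose t := Num.max a (c - eta / 2).
  have tc : t < c by rewrite gt_max ac'/=; lra.
  have at_ : a <= t by rewrite le_max lexx.
  have ct : `|t - c| = c - t by rewrite distrC gtr0_norm ?subr_gt0.
  have : c - eta / 2 <= t by rewrite le_max lexx orbT.
  move=> tl; have := loc t; rewrite ct => /(_ _)/wrap[]; first by lra.
  have := good t; rewrite at_ tc => /(_ isT) h1 h2.
  rewrite -[f c - f a](subrKA (f t)) (le_trans (ler_normD _ _))//.
  rewrite distrC (le_trans (lerD h2 h1))// -mulrDr; apply: ler_wpM2l => //.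
  by lra.
have [t [/andP[at_ tb] bt] tc] := inf_adherent eta0 hinf.
have ct : c <= t by apply: (ge_inf (proj2 hinf)); split => //; rewrite at_.
have tcE : `|t - c| = t - c by rewrite ger0_norm ?subr_ge0.
have := loc t; rewrite tcE => /(_ _)/wrap[]; first by rewrite -/c in tc; lra.
move=> h2; move: bt; rewrite ltNge => /negP; apply.
rewrite -[f t - f a](subrKA (f c)) (le_trans (ler_normD _ _))//.
rewrite (le_trans (lerD h2 gc))// -mulrDr; apply: ler_wpM2l => //.
by lra.
Qed.

Lemma is_derive_scale_cst (R : realType) (Y : normedModType R) (p : R -> R)
    (s dp : R) (v : Y) :
  is_derive s 1 p dp -> is_derive s 1 (fun u => p u *: v) (dp *: v).
Proof.
move=> [dps <-].
have H : (fun h : R => h^-1 *: (((fun u => p u *: v) \o shift s) (h *: 1) - p s *: v))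
    @ 0^' --> 'D_1 p s *: v.
  rewrite [X in X @ _](_ : _ = fun h : R =>
    (h^-1 *: ((p \o shift s) (h *: 1) - p s)) *: v); last first.
    by rewrite funeqE => h /=; rewrite -scalerBl scalerA.
  exact: cvgZr_tmp.
by split; [apply/cvg_ex; eexists; exact: H|exact: cvg_lim H].
Qed.

(** Here [phi j] plays the j-th derivative. Induction on [m], applied to [phi 1]: the coefficients
    are antidifferentiated and the remainder is recovered by the mean value inequality. This loses
    the factor [1 / m!], which is harmless; of the coefficients only the constant one has to be
    identified. *)
Lemma taylor_expansion (R : realType) (Y : normedModType R) (a b K t : R)
    (m : nat) (phi : nat -> R -> Y) :
  a < t < b ->
  (forall j s, (j < m)%N -> a < s < b -> is_derive s 1 (phi j) (phi j.+1 s)) ->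
  (forall s, a < s < b -> `|phi m s| <= K) ->
  exists2 c : nat -> Y, c 0%N = phi 0%N t &
    forall s, a < s < b ->
      `|phi 0%N s - \sum_(j < m) (s - t) ^+ j *: c j| <= K * `|s - t| ^+ m.
Proof.
move=> tab; elim: m phi => [|m IH] phi dphi phiK.
  exists (fun=> phi 0%N t) => // s sab.
  by rewrite big_ord0 subr0 expr0 mulr1 phiK.
have [||c' _ Hc'] := IH (fun j => phi j.+1).
- by move=> j s jm; exact: dphi.
- exact: phiK.
pose c j := if j is j'.+1 then j'.+1%:R^-1 *: c' j' else phi 0%N t.
exists c => // s sab.
(* Up to the constant [phi 0 t], [r] is the new remainder; its derivative [dr] is the remainder of
   [phi 1], bounded by the induction hypothesis. *)
pose r u := phi 0%N u - \sum_(j < m) ((u - t) ^+ j.+1 / j.+1%:R) *: c' j.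
pose dr u := phi 1%N u - \sum_(j < m) (u - t) ^+ j *: c' j.
have rE : phi 0%N s - \sum_(j < m.+1) (s - t) ^+ j *: c j = r s - r t.
  have -> : r t = phi 0%N t.
    rewrite /r big1 ?subr0// => j _.
    by rewrite subrr expr0n mul0r scale0r.
  rewrite big_ord_recl /= expr0 scale1r /r opprD addrA addrAC; congr (_ - _ - _).
  by apply: eq_bigr => j _; rewrite scalerA.
have drE u : a < u < b -> is_derive u 1 r (dr u).
  move=> uab; rewrite /r /dr.
  have -> : (fun u => phi 0%N u - \sum_(j < m) ((u - t) ^+ j.+1 / j.+1%:R) *: c' j)
      = phi 0%N - \sum_(j < m) (fun u => ((u - t) ^+ j.+1 / j.+1%:R) *: c' j).
    by apply/funext => v; rewrite /= fctE fct_sumE.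
  apply: is_deriveB; first exact: dphi.
  apply: is_derive_sum => j; apply: is_derive_scale_cst.
  have -> : (fun v => (v - t) ^+ j.+1 / j.+1%:R) =
      j.+1%:R^-1 \*: ((id - cst t) ^+ j.+1 : R -> R).
    by apply/funext => v; rewrite /= fctE/= /GRing.scale/= mulrC.
  apply: is_derive_eq; rewrite /= subr0 /GRing.scale/= mulr1 mulrA mulVf ?mul1r//.
rewrite rE; have main x y : a < x -> x <= y -> y < b -> (forall u, x <= u <= y ->
    `|u - t| <= `|s - t|) -> `|r y - r x| <= K * `|s - t| ^+ m * (y - x).
  move=> ax xy yb H; have xyab u : x <= u <= y -> a < u < b.
    by move=> /andP[xu uy]; rewrite (lt_le_trans ax xu) (le_lt_trans uy yb).
  apply: (mean_value_ineq xy (fun u uxy => drE u (xyab u uxy))) => u uxy.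
  have ut : a < u < b by exact: xyab.
  rewrite (le_trans (Hc' _ ut))// ler_wpM2l ?(le_trans (normr_ge0 _) (phiK _ tab))//.
  by rewrite lerXn2r ?nnegrE ?H.
have /andP[sa sb] := sab; have /andP[ta tb] := tab.
have [st|ts] := leP s t.
  have -> : `|s - t| ^+ m.+1 = `|s - t| ^+ m * (t - s).
    by rewrite exprSr distrC [X in _ * X]ger0_norm ?subr_ge0.
  rewrite mulrA distrC; apply: main => // u /andP[su ut].
  by rewrite !ler0_norm ?subr_le0//; lra.
have -> : `|s - t| ^+ m.+1 = `|s - t| ^+ m * (s - t).
  by rewrite exprSr [X in _ * X]gtr0_norm ?subr_gt0.
rewrite mulrA; apply: main => //; first exact: ltW.
move=> u /andP[tu us].
by rewrite !ger0_norm ?subr_ge0//; lra.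
Qed.

(** * Lagrange interpolation on one block of the unit interval *)

(** Node [k] of block [c] among [n] blocks. The denominator [m.+1] keeps the nodes strictly inside
    the block, hence in the open interval, where derivatives are available. *)
Definition node (R : realType) (n m c k : nat) : R :=
  (c%:R + k.+1%:R / m.+1%:R) / n%:R.

Lemma node_itv (R : realType) (n m c k : nat) : (0 < n)%N -> (k < m)%N ->
  c%:R / n%:R < node R n m c k < c.+1%:R / n%:R.
Proof.
move=> n0 km; have n0' : 0 < n%:R^-1 :> R by rewrite invr_gt0 ltr0n.
rewrite /node !ltr_pM2r// ltrDl divr_gt0 ?ltr0n//= -(natr1 c) ltrD2l.
by rewrite ltr_pdivrMr ?ltr0n// mul1r ltr_nat.
Qed.

Lemma node_in01 (R : realType) (n m c k : nat) : (c < n)%N -> (k < m)%N ->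
  0 < node R n m c k < 1.
Proof.
move=> cn km; have n0 : (0 < n)%N by exact: leq_ltn_trans cn.
have /andP[h1 h2] := node_itv R c n0 km.
rewrite (le_lt_trans _ h1) ?divr_ge0//= (lt_le_trans h2)//.
by rewrite ler_pdivrMr ?ltr0n// mul1r ler_nat.
Qed.

Lemma dist_node (R : realType) (n m c k : nat) (t : R) : (0 < n)%N -> (k < m)%N ->
  c%:R / n%:R <= t <= c.+1%:R / n%:R -> `|node R n m c k - t| <= n%:R^-1.
Proof.
move=> n0 km /andP[t1 t2]; have /andP[h1 h2] := node_itv R c n0 km.
have e : c.+1%:R / n%:R = c%:R / n%:R + n%:R^-1 :> R.
  by rewrite -natr1 mulrDl mul1r.
by rewrite ler_distl; lra.
Qed.

Lemma node_inj (R : realType) (n m c : nat) : (0 < n)%N ->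
  injective (node R n m c).
Proof.
move=> n0 j k /(mulIf _)/wrap[]; first by rewrite invr_eq0 pnatr_eq0 -lt0n.
move=> /addrI /(mulIf _)/wrap[]; first by rewrite invr_eq0 pnatr_eq0.
by move=> /eqP; rewrite eqr_nat => /eqP [].
Qed.

Lemma node_sep (R : realType) (n m c j k : nat) : (0 < n)%N -> j != k ->
  (m.+1%:R * n%:R)^-1 <= `|node R n m c k - node R n m c j|.
Proof.
move=> n0 jk; rewrite /node -mulrBl opprD addrACA subrr add0r -mulrBl !normrM invfM.
rewrite !normfV !normr_nat; apply: ler_wpM2r; first by rewrite invr_ge0.
rewrite ler_pMl ?invr_gt0 ?ltr0n// -(natr1 k) -(natr1 j) opprD addrACA subrr addr0.
have [h|h|h] := ltngtP j k; last by rewrite h eqxx in jk.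
  by rewrite -natrB ?(ltnW h)// normr_nat ler1n subn_gt0.
by rewrite distrC -natrB ?(ltnW h)// normr_nat ler1n subn_gt0.
Qed.

(** The weights are the Lagrange basis polynomials evaluated at [t]. Each factor is a distance at
    most [1 / n] over a node gap at least [1 / (m.+1 * n)], hence at most [m.+1], whatever [n]
    is. *)
Lemma lagrange_weights (R : realType) (n m c : nat) (t : R) :
  (0 < n)%N -> (0 < m)%N -> c%:R / n%:R <= t <= c.+1%:R / n%:R ->
  exists2 w : 'I_m -> R, (forall k, `|w k| <= m.+1%:R ^+ m) &
    forall j, (j < m)%N -> \sum_(k < m) w k * (node R n m c k - t) ^+ j = 0 ^+ j.
Proof.
move=> n0 m0 tc; have xinj := @node_inj R n m c n0.
set x := node R n m c in xinj *.
exists (fun k => ((tnth (lagrange m x) k) : {poly R}).[t]) => [k|j jm].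
  rewrite lagrangeE// hornerM hornerC !horner_prod -prodfV -big_split/=.
  rewrite normr_prod -[X in _ <= _ ^+ X]card_ord -prodr_const.
  rewrite [leRHS](bigD1 k)//=.
  (* The basis polynomial has only [m - 1] factors; the missing one is replaced by [m.+1], which is
     at least 1. *)
  apply: (@le_trans _ _ (\prod_(i < m | i != k) m.+1%:R)); last first.
    by rewrite ler_peMl ?ler1n// prodr_ge0.
  apply: ler_prod => i ik; rewrite normr_ge0/= !hornerXsubC normrM normfV.
  rewrite ler_pdivrMl ?normr_gt0 ?subr_eq0 ?(inj_eq xinj) 1?eq_sym//.
  rewrite distrC (le_trans (dist_node n0 (ltn_ord i) tc))//.
  have := node_sep R m c n0 ik; rewrite -/x => h.
  rewrite -ler_pdivrMr ?ltr0n// (le_trans _ h)//.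
  by rewrite invfM mulrC.
have sz : (size (('X - t%:P) ^+ j)%R <= m)%N by rewrite size_exp_XsubC.
(* Interpolation reproduces [('X - t) ^+ j], of degree below [m]; its value at [t] is [0 ^+ j]. *)
have := congr1 (horner^~ t) (lagrange_gen m0 xinj sz).
rewrite /= horner_exp hornerXsubC subrr => ->.
rewrite horner_sum; apply: eq_bigr => k _.
by rewrite hornerM hornerC horner_exp hornerXsubC mulrC.
Qed.

(** The weights annihilate every Taylor term except [v 0 = f t], so [f t] is a weighted sum of
    Taylor polynomial values at the nodes. Each of these is within [K / n ^ m] of a value of [f]
    bounded by [e]. *)
Lemma interpolation_bound (R : realType) (Y : normedModType R) (f : R -> Y)
    (n m c : nat) (t K e : R) (v : nat -> Y) :
  (c < n)%N -> (0 < m)%N ->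
  c%:R / n%:R <= t <= c.+1%:R / n%:R -> v 0%N = f t ->
  (forall s, 0 < s < 1 ->
    `|f s - \sum_(j < m) (s - t) ^+ j *: v j| <= K * `|s - t| ^+ m) ->
  (forall k, (k < m)%N -> `|f (node R n m c k)| <= e) -> 0 <= K ->
  `|f t| <= m%:R * m.+1%:R ^+ m * (e + K / n%:R ^+ m).
Proof.
move=> cn m0 tc v0 fv fe K0; have n0 : (0 < n)%N by exact: leq_ltn_trans cn.
have [w wL wE] := lagrange_weights n0 m0 tc.
have -> : f t = \sum_(k < m) w k *: \sum_(j < m) (node R n m c k - t) ^+ j *: v j.
  under eq_bigr do rewrite scaler_sumr.
  rewrite exchange_big/= (bigD1 (Ordinal m0))//= [X in _ + X]big1 => [|j j0].
    rewrite addr0 -v0; under eq_bigr do rewrite scalerA.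
    by rewrite -scaler_suml (wE _ m0) expr0 scale1r.
  under eq_bigr do rewrite scalerA.
  rewrite -scaler_suml (wE _ (ltn_ord j)) expr0n; case: eqP => [j0'|]; last first.
    by rewrite scale0r.
  by case/eqP: j0; apply: val_inj.
rewrite (le_trans (ler_norm_sum _ _ _))// -mulrA.
rewrite -[X in X%:R * _]card_ord mulr_natl -sumr_const; apply: ler_sum => k _.
rewrite normrZ ler_pM//.
set x := node _ _ _ _ _; rewrite -[X in `|X|](subrK (f x)) addrC.
rewrite (le_trans (ler_normD _ _))// lerD ?fe// distrC.
rewrite (le_trans (fv _ (node_in01 R cn (ltn_ord k))))// ler_wpM2l// -exprVn.
by rewrite lerXn2r ?nnegrE ?invr_ge0// dist_node.
Qed.

Lemma block_exists (R : realType) (n : nat) (t : R) : (0 < n)%N -> 0 < t < 1 ->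
  exists c : 'I_n, c%:R / n%:R <= t <= c.+1%:R / n%:R.
Proof.
move=> n0 /andP[t0 t1]; have n0' : 0 < n%:R :> R by rewrite ltr0n.
have tn : 0 <= t * n%:R by rewrite mulr_ge0// ltW.
have /andP[h1 h2] := truncn_itv tn.
have cn : (Num.truncn (t * n%:R) < n)%N.
  by rewrite -(ltr_nat R) (le_lt_trans h1)// gtr_pMl.
by exists (Ordinal cn); rewrite /= ler_pdivrMr// ler_pdivlMr// h1 ltW.
Qed.

(** * Taylor expansion along coordinate lines *)

(** Written as a shift along a basis vector, so that the difference quotient in [s] is literally the
    one defining the partial derivative. *)
Definition set_coord (R : realType) (d : nat) (x : 'rV[R]_d) (i : 'I_d) (s : R)
  : 'rV[R]_d := x + (s - x ord0 i) *: delta_mx 0 i.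

Lemma set_coordE (R : realType) (d : nat) (x : 'rV[R]_d) (i j : 'I_d) (s : R) :
  set_coord x i s ord0 j = if j == i then s else x ord0 j.
Proof.
rewrite !mxE eqxx/=; case: eqP => [->|]; last by rewrite mulr0 addr0.
by rewrite mulr1 addrC subrK.
Qed.

Lemma set_coord_id (R : realType) (d : nat) (x : 'rV[R]_d) (i : 'I_d) :
  set_coord x i (x ord0 i) = x.
Proof. by rewrite /set_coord subrr scale0r addr0. Qed.

Lemma set_coord_int (R : realType) (d : nat) (x : 'rV[R]_d) (i : 'I_d) (s : R) :
  cube_int d x -> 0 < s < 1 -> cube_int d (set_coord x i s).
Proof. by move=> xint s01 j; rewrite set_coordE; case: eqP. Qed.

Lemma is_derive_line (R : realType) (Y : normedModType R) (d : nat)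
    (F : 'rV[R]_d -> Y) (x : 'rV[R]_d) (i : 'I_d) (s : R) :
  derivable F (set_coord x i s) (delta_mx 0 i) ->
  is_derive s 1 (fun u => F (set_coord x i u)) (partial i F (set_coord x i s)).
Proof.
move=> dF.
have H : (fun h : R => h^-1 *: (((fun u => F (set_coord x i u)) \o shift s) (h *: 1)
    - F (set_coord x i s))) @ 0^' --> partial i F (set_coord x i s).
  rewrite [X in X @ _](_ : _ = fun h : R => h^-1 *:
    ((F \o shift (set_coord x i s)) (h *: delta_mx 0 i) - F (set_coord x i s)));
    first exact: dF.
  rewrite funeqE => h /=; congr (_ *: (F _ - _)).
  rewrite /set_coord [h *: 1]mulr1.
  by rewrite -addrA scalerDl addrCA.
by split; [apply/cvg_ex; eexists; exact: H|exact: cvg_lim H].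
Qed.

Lemma flatten_nseq_single (T : eqType) (i : T) (j : nat) (s : seq T) : uniq s ->
  flatten [seq nseq (if k == i then j else 0) k | k <- s] =
    if i \in s then nseq j i else [::].
Proof.
elim: s => //= a s IH /andP[as_ us]; rewrite IH// in_cons.
by case: (eqVneq a i) as_ => [->|//] /negbTE ->; rewrite cats0.
Qed.

(** Take the multi-index with [m] in position [i] and 0 elsewhere; the lower orders come from
    unfolding [Dexists]. *)
Lemma Gclass_pure_partial (R : realType) (Y : normedModType R) (d m : nat)
    (B : set Y) (g : 'rV[R]_d -> Y) (i : 'I_d) : Gclass d m B g ->
  (forall j x, (j < m)%N -> cube_int d x ->
    derivable (Diter (nseq j i) g) x (delta_mx 0 i)) /\
  (forall x, cube_int d x -> B (Diter (nseq m i) g x)).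
Proof.
move=> [_ [_ Hg]]; pose p (k : 'I_d) := if k == i then m else 0%N.
have pE : mindex_seq p = nseq m i.
  by rewrite /mindex_seq /p flatten_nseq_single ?enum_uniq// mem_enum.
have [|] := Hg p; first by rewrite /mindex_order /p -big_mkcond big_pred1_eq.
rewrite /Dmulti pE => Dg gB; split => // {pE gB}.
elim: {p Hg} m Dg => // m IH [/IH {}IH Dm] j x.
by rewrite ltnS leq_eqVlt => /predU1P[->|jm]; [exact: Dm|exact: IH].
Qed.

Lemma Gclass_taylor (R : realType) (Y : normedModType R) (d m : nat) (K : R)
    (B : set Y) (g : 'rV[R]_d -> Y) (i : 'I_d) (x : 'rV[R]_d) :
  (forall y, B y -> `|y| <= K) -> Gclass d m B g -> cube_int d x ->
  exists2 v : nat -> Y, v 0%N = g x &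
    forall s, 0 < s < 1 ->
    `|g (set_coord x i s) - \sum_(j < m) (s - x ord0 i) ^+ j *: v j|
      <= K * `|s - x ord0 i| ^+ m.
Proof.
move=> BK /(@Gclass_pure_partial _ _ _ _ _ _ i)[dg gB] xint.
have [|||v v0 vE] := @taylor_expansion R Y 0 1 K (x ord0 i) m
  (fun j u => Diter (nseq j i) g (set_coord x i u)).
- exact: xint.
- by move=> j s jm s01; apply: is_derive_line; apply: dg => //; exact: set_coord_int.
- by move=> s s01; apply/BK/gB/set_coord_int.
by exists v => //; rewrite v0 set_coord_id.
Qed.

(** * Interpolation on the product grid *)

Definition grid_point (R : realType) (d n m : nat)
    (q : {ffun 'I_d -> 'I_n * 'I_m}) : 'rV[R]_d :=
  \row_i node R n m (q i).1 (q i).2.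
Arguments grid_point R {d n m} q.

(* Induction on the number r of coordinates that are not yet grid coordinates:
   one-dimensional interpolation in the last free coordinate costs a factor L. *)
Lemma tensor_interpolation_bound (R : realType) (Y : normedModType R)
    (d n m : nat) (f : 'rV[R]_d -> Y) (K e : R) :
  (0 < n)%N -> (0 < m)%N -> 0 <= K -> 0 <= e ->
  (forall x i, cube_int d x ->
    exists2 v : nat -> Y, v 0%N = f x &
    forall s, 0 < s < 1 ->
    `|f (set_coord x i s) - \sum_(j < m) (s - x ord0 i) ^+ j *: v j|
      <= K * `|s - x ord0 i| ^+ m) ->
  (forall q : {ffun 'I_d -> 'I_n * 'I_m}, `|f (grid_point R q)| <= e) ->
  forall x, cube_int d x ->
    `|f x| <= (m%:R * m.+1%:R ^+ m) ^+ d * (e + d%:R * (K / n%:R ^+ m)).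
Proof.
move=> n0 m0 K0 e0 fT fe; set L := m%:R * _; set E := K / _.
have E0 : 0 <= E by rewrite divr_ge0// exprn_ge0.
have L1 : 1 <= L by rewrite mulr_ege1 ?ler1n// exprn_ege1// ler1n.
have L0 : 0 <= L by rewrite (le_trans _ L1).
suff H r x : cube_int d x ->
    (forall i : 'I_d, (r <= i)%N ->
      exists q : 'I_n * 'I_m, x ord0 i = node R n m q.1 q.2) ->
    `|f x| <= L ^+ r * (e + r%:R * E).
  move=> x xint; apply: H => // i.
  by rewrite leqNgt ltn_ord.
elim: r x => [|r IH] x xint xr.
  have {}xr i := xr i (leq0n i).
  have [q qE] := choice xr.
  have -> : x = grid_point R [ffun i => q i].
    by apply/rowP => i; rewrite mxE ffunE.
  by rewrite mul0r addr0 mul1r fe.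
(* Since [L >= 1], the fresh error [E] is absorbed into [L ^+ r * E]. *)
have step : L * (L ^+ r * (e + r%:R * E) + E) <= L ^+ r.+1 * (e + r.+1%:R * E).
  rewrite exprS -mulrA; apply: ler_wpM2l => //.
  rewrite -(natr1 r) mulrDl mul1r addrA [leRHS]mulrDr lerD2l.
  by rewrite ler_peMl// exprn_ege1.
have B0 : 0 <= L ^+ r * (e + r%:R * E).
  by rewrite mulr_ge0 ?exprn_ge0// addr_ge0// mulr_ge0.
(* For [r >= d] there is no coordinate of index [r] to interpolate, and the bound only grows. *)
have [rd|dr] := ltnP r d; last first.
  rewrite (le_trans _ step)// (@le_trans _ _ (L ^+ r * (e + r%:R * E)))//.
    by apply: IH => // i ri; have := ltn_ord i; rewrite ltnNge (leq_trans dr ri).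
  by rewrite (le_trans _ (ler_peMl _ L1)) ?lerDl// addr_ge0.
pose i := Ordinal rd.
have [c tc] := block_exists n0 (xint i).
have [v v0 vE] := fT x i xint.
rewrite -[x in f x](set_coord_id x i) (le_trans _ step)//.
apply: (@interpolation_bound _ _ (fun s => f (set_coord x i s)) n m c _ K _ v) => //.
  by rewrite set_coord_id.
move=> k km; have knode := node_in01 R (ltn_ord c) km.
apply: IH; first exact: set_coord_int.
move=> j rj; rewrite set_coordE; case: eqP => [_|/eqP ji].
  by exists (c, Ordinal km).
by apply: xr; rewrite ltn_neqAle rj andbT eq_sym.
Qed.

(** * Covers from finite codes, and entropy bounds from covers *)

Lemma In_mem (T : eqType) (x : T) (s : seq T) : List.In x s -> x \in s.
Proof.
elim: s => //= y s IH [->|/IH xs]; rewrite in_cons ?eqxx// xs orbT.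
by [].
Qed.

Lemma In_pmap (T : eqType) (U : Type) (f : T -> option U) (s : seq T) (y : U) :
  List.In y (pmap f s) <-> exists2 x, x \in s & f x = Some y.
Proof.
elim: s => [|x s IH] /=; first by split=> [//|[]].
case fx : (f x) => [z|] /=.
  rewrite IH; split=> [[<-|[u us fu]]|[u + fu]].
  - by exists x => //; rewrite mem_head.
  - by exists u => //; rewrite in_cons us orbT.
  rewrite in_cons => /predU1P[ux|us]; last by right; exists u.
  by left; move: fu; rewrite ux fx => -[].
rewrite IH; split=> -[u us fu]; exists u => //.
  by rewrite in_cons us orbT.
by move: us; rewrite in_cons => /predU1P[ux|//]; move: fu; rewrite ux fx.
Qed.

(** Centres must lie in [Z], so each code that occurs is represented by some element of [Z] carrying
    it; codes that do not occur are dropped. *)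
Lemma covers_by_codes (R : realType) (T : Type) (rho : T -> T -> \bar R)
    (Z : set T) (delta : R) (C : finType) (P : C -> T -> Prop) :
  (forall z, Z z -> exists c, P c z) ->
  (forall c z z', Z z -> Z z' -> P c z -> P c z' -> (rho z z' <= delta%:E)%E) ->
  exists2 s, covers rho Z delta s & (size s <= #|C|)%N.
Proof.
move=> ZP Pclose.
have /choice[rep repP] : forall c, exists o : option T,
    if o is Some z then Z z /\ P c z else forall z, Z z -> ~ P c z.
  move=> c; have [[z Pz]|nP] := pselect (exists z, Z z /\ P c z).
    by exists (Some z).
  by exists None => z Zz Pz; apply: nP; exists z.
exists (pmap rep (enum C)); last first.
  by rewrite size_pmap (leq_trans (count_size _ _))// cardE.
split=> [z /In_pmap[c _ cz]|z Zz].
  by have := repP c; rewrite cz => -[].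
have [c Pcz] := ZP z Zz; have := repP c.
case cE : (rep c) => [z'|]; last by move=> /(_ z Zz).
move=> [Zz' Pcz']; exists z'; last exact: (Pclose c).
by apply/In_pmap; exists c => //; rewrite mem_enum.
Qed.

Lemma metric_entropy_le (R : realType) (T : Type) (rho : T -> T -> \bar R)
    (Z : set T) (delta E : R) (s : seq T) :
  covers rho Z delta s -> (size s)%:R <= expR E ->
  (metric_entropy rho Z delta <= E%:E)%E.
Proof.
move=> sZ sE; rewrite /metric_entropy.
have : (covering_number rho Z delta <= (size s)%:R%:E)%E.
  by apply: ereal_inf_lbound; exists s.
have : (0 <= covering_number rho Z delta)%E.
  by apply: le_ereal_inf_tmp => _ [u _ <-]; rewrite lee_fin.
case: covering_number => [r| |]; rewrite ?leNye//.
(* A zero covering number has entropy [-oo] by definition. *)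
rewrite !lee_fin => r0 rs; case: eqP => [_|/eqP rn0]; first by rewrite leNye.
by rewrite lee_fin -[E]expRK ler_ln ?posrE ?expR_gt0 ?lt0r ?rn0// (le_trans rs).
Qed.

(** The extra 1 in the exponent makes the inequality strict, so a cover can be extracted without
    showing that the infimum is attained. *)
Lemma covering_number_cover (R : realType) (T : Type) (rho : T -> T -> \bar R)
    (Z : set T) (eps a : R) :
  (covering_number rho Z eps <= (expR a)%:E)%E ->
  exists2 s, covers rho Z eps s & (size s)%:R <= expR (a + 1).
Proof.
move=> h; have : (covering_number rho Z eps < (expR (a + 1))%:E)%E.
  by rewrite (le_lt_trans h)// lte_fin ltr_expR ltrDl.
move=> /ereal_inf_lt[_ [s sZ <-]]; rewrite lte_fin => /ltW ?.
by exists s.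
Qed.

(** * Covering the smoothness class *)

Lemma cube_le_of_int (R : realType) (Y : normedModType R) (d : nat)
    (g h : 'rV[R]_d -> Y) (delta : R) :
  {within cube d, continuous g} -> {within cube d, continuous h} ->
  (forall x, cube_int d x -> `|g x - h x| <= delta) ->
  forall x, cube d x -> `|g x - h x| <= delta.
Proof.
move=> /subspace_continuousP gc /subspace_continuousP hc H x xc.
have fc : (g y - h y) @[y --> within (cube d) (nbhs x)] --> g x - h x.
  by apply: cvgB; [exact: gc|exact: hc].
apply/ler_addgt0Pr => e e0.
have /cvgrPdist_lt /(_ _ e0) nearx := fc.
(* The segment from [x] to the centre of the cube is interior for small [l > 0]; continuity on the
   cube transfers the bound to [x]. *)
pose gam (l : R) : 'rV[R]_d := x + l *: (const_mx 2^-1 - x).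
have gam0 : gam l @[l --> 0] --> x.
  have : gam l @[l --> 0] --> x + 0 *: (const_mx 2^-1 - x).
    by apply: cvgD; [exact: cvg_cst|apply: cvgZr_tmp; exact: cvg_id].
  by rewrite scale0r addr0.
have /gam0 /= [r /= r0 near0] := nearx.
pose l := Num.min (r / 2) 2^-1.
have l0 : 0 < l by rewrite lt_min divr_gt0//= invr_gt0.
have lr : l < r by rewrite (@le_lt_trans _ _ (r / 2)) ?ge_min ?lexx//; lra.
have l2 : l <= 2^-1 by rewrite ge_min lexx orbT.
have gint : cube_int d (gam l).
  move=> i; rewrite !mxE; have /andP[xi0 xi1] := xc i.
  by apply/andP; split; nra.
have gcube : cube d (gam l).
  by move=> i; have /andP[? ?] := gint i; rewrite !ltW.
have := near0 l; rewrite /ball_/= sub0r normrN gtr0_norm// => /(_ lr gcube) /ltW hl.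
rewrite -[X in `|X|](subrK (g (gam l) - h (gam l))) (le_trans (ler_normD _ _))//.
by rewrite addrC lerD// H.
Qed.

(** Tensor interpolation is applied to [g - h]: subtracting the two Taylor expansions gives one with
    remainder constant [2 * K]. *)
Lemma Gclass_close_of_grid (R : realType) (Y : normedModType R) (d n m : nat)
    (B : set Y) (K e : R) (g h : 'rV[R]_d -> Y) :
  (0 < n)%N -> (0 < m)%N -> 0 <= K -> 0 <= e ->
  (forall y, B y -> `|y| <= K) -> Gclass d m B g -> Gclass d m B h ->
  (forall q : {ffun 'I_d -> 'I_n * 'I_m},
    `|g (grid_point R q) - h (grid_point R q)| <= e) ->
  (sup_dist d g h <= ((m%:R * m.+1%:R ^+ m) ^+ d *
    (e + d%:R * (2 * K / n%:R ^+ m)))%:E)%E.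
Proof.
move=> n0 m0 K0 e0 BK Gg Gh gh; apply: ge_ereal_sup => _ [x xc <-].
rewrite lee_fin; apply: cube_le_of_int xc; [exact: Gg.1|exact: Gh.1|move=> {}x].
apply: (@tensor_interpolation_bound R Y d n m (fun x => g x - h x)) => //.
  by rewrite mulr_ge0.
move=> {}x i xint.
have [v v0 vE] := Gclass_taylor i BK Gg xint.
have [w w0 wE] := Gclass_taylor i BK Gh xint.
exists (fun j => v j - w j) => [|s s01]; first by rewrite v0 w0.
under eq_bigr do rewrite scalerBr.
rewrite sumrB opprD addrACA -opprD -mulrA (le_trans (ler_normB _ _))//.
by rewrite mulrDl mul1r lerD ?vE ?wE.
Qed.

Lemma Gclass_cover (R : realType) (Y : normedModType R) (d n m : nat)
    (B : set Y) (K e : R) (s : seq Y) :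
  (0 < n)%N -> (0 < m)%N -> 0 <= K -> 0 <= e ->
  (forall y, B y -> `|y| <= K) -> covers norm_dist B e s ->
  exists2 S, covers (sup_dist d) (Gclass d m B)
    ((m%:R * m.+1%:R ^+ m) ^+ d * (2 * e + d%:R * (2 * K / n%:R ^+ m))) S &
    (size S <= size s ^ ((n * m) ^ d))%N.
Proof.
move=> n0 m0 K0 e0 BK [_ sB].
pose Q := {ffun 'I_d -> 'I_n * 'I_m}.
(* A code assigns to each grid point a net element near the value there. Two functions with the same
   code differ by at most [2 * e] on the grid. *)
pose P (c : {ffun Q -> 'I_(size s)}) (g : 'rV[R]_d -> Y) :=
  forall q, `|g (grid_point R q) - nth 0 s (c q)| <= e.
have cardC : #|{ffun Q -> 'I_(size s)}| = (size s ^ ((n * m) ^ d))%N.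
  by rewrite card_ffun card_ord card_ffun card_prod !card_ord.
rewrite -cardC; apply: (@covers_by_codes _ _ _ _ _ _ P) => [g Gg|c g h Gg Gh Pg Ph].
  have : forall q : Q, exists k : 'I_(size s),
      `|g (grid_point R q) - nth 0 s k| <= e.
    move=> q; have Bq : B (g (grid_point R q)).
      apply: Gg.2.1 => i; rewrite mxE.
      by have /andP[/ltW -> /ltW ->] := node_in01 R (ltn_ord (q i).1) (ltn_ord (q i).2).
    have [y /In_mem ys] := sB _ Bq; rewrite lee_fin => gy.
    have ks : (index y s < size s)%N by rewrite index_mem.
    by exists (Ordinal ks); rewrite /= nth_index.
  move=> /choice[c cP]; exists [ffun q => c q] => q.
  by rewrite ffunE.
apply: (Gclass_close_of_grid n0 m0 K0 _ BK Gg Gh); first by rewrite mulr_ge0.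
move=> q; rewrite -[g _ - _](subrKA (nth 0 s (c q))) (le_trans (ler_normD _ _))//.
by rewrite mulrDl mul1r lerD ?Pg// distrC Ph.
Qed.

(** * Choice of the grid and net sizes *)

Unset Implicit Arguments. Set Strict Implicit. Set Printing Implicit Defensive.

Theorem theorem4 (R : realType) (d m : nat) (hd : (1 <= d)%N) (hm : (1 <= m)%N)
  (M tau K_B : R) (hM : 0 < M) (htau : 0 < tau) (hKB : 0 < K_B) :
  exists K : R,
  forall (Y : completeNormedModType R),
    parallelogram_law Y -> separable_space Y ->
  forall B : set Y,
    (forall eps : R, 0 < eps ->
       (covering_number (@norm_dist R Y) B eps <= (expR (M * eps `^ (- tau)))%:E)%E) ->
    (forall y, B y -> `|y| <= K_B) ->
    exists2 delta0 : R, 0 < delta0 &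
      forall delta : R, 0 < delta < delta0 ->
        (metric_entropy (@sup_dist R Y d) (Gclass d m B) delta
          <= (K * delta `^ (- (d%:R / m%:R + tau)))%:E)%E.
Proof.
pose L : R := (m%:R * m.+1%:R ^+ m) ^+ d.
have L0 : 0 < L by rewrite exprn_gt0// mulr_gt0 ?ltr0n// exprn_gt0.
(* Chosen so that [2 * d * L * K_B / c0 <= 1 / 2]: the interpolation error then uses half of
   [delta]. The equation keeps [c0] opaque. *)
have [c0 c0E] : exists c : R, c = 1 + 4 * d%:R * L * K_B by eexists.
have c1 : 1 <= c0.
  by rewrite c0E lerDl !mulr_ge0// ?(ltW L0)// ltW.
(* The first factor comes from the number of grid points, the second from the entropy of the net,
   each with its power of [delta] removed. *)
exists (((c0 + 1) * m%:R) ^+ d * (M * (4 * L) `^ tau + 1)).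
move=> Y _ _ B Bcov BK; exists 1 => // delta /andP[d0 d1].
pose a := delta `^ (- m%:R^-1).
have m0 : 0 < m%:R :> R by rewrite ltr0n.
have am : a ^+ m = delta^-1.
  by rewrite -powR_mulrn ?powR_ge0// -powRrM mulNr mulVf ?gt_eqF// powR_inv1// ltW.
have ad : a ^+ d = delta `^ (- (d%:R / m%:R)).
  by rewrite -powR_mulrn ?powR_ge0// -powRrM mulNr mulrC.
have pow1 r : 0 < r -> 1 <= delta `^ (- r).
  move=> r0; rewrite -(powRr0 delta) ger_powR ?d0 ?(ltW d1)//.
  by rewrite oppr_le0 ltW.
have a1 : 1 <= a by rewrite pow1// invr_gt0.
have ca0 : 0 <= c0 * a by rewrite mulr_ge0//; lra.
(* With [a = delta ^ (-1/m)], this gives [c0 * a < n <= (c0 + 1) * a]: fine enough for the error,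
   coarse enough for the count. *)
pose n := (Num.truncn (c0 * a)).+1.
have /andP[n1 n2] := truncn_itv ca0.
have nle : n%:R <= (c0 + 1) * a.
  by rewrite /n -natr1 mulrDl mul1r lerD.
have nm : c0 * delta^-1 <= n%:R ^+ m.
  rewrite (@le_trans _ _ ((c0 * a) ^+ m))//; last first.
    by rewrite lerXn2r ?nnegrE// ltW.
  rewrite exprMn am ler_wpM2r ?invr_ge0 ?(ltW d0)//.
  by rewrite ler_eXnr.
(* Rounding contributes [L * (2 * e)], the other half of [delta]. *)
pose e := delta / (4 * L).
have e0 : 0 < e by rewrite divr_gt0// mulr_gt0.
have [s sB sE] := covering_number_cover (Bcov e e0).
have [S SG Ss] := @Gclass_cover R Y d n m B K_B e s (ltn0Sn _) hm (ltW hKB) (ltW e0) BK sB.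
have rad : L * (2 * e + d%:R * (2 * K_B / n%:R ^+ m)) <= delta.
  have nd : (n%:R ^+ m)^-1 <= delta / c0.
    rewrite -[delta]invrK -invfM mulrC lef_pV2 ?posrE ?exprn_gt0 ?ltr0n//.
    by rewrite mulr_gt0 ?invr_gt0//; lra.
  have h1 : L * (2 * e) = delta / 2.
    by rewrite /e; field; rewrite gt_eqF.
  have h2 : L * (d%:R * (2 * K_B / n%:R ^+ m)) <= delta / 2.
    have A0 : 0 <= L * d%:R * 2 * K_B by rewrite !mulr_ge0// ltW.
    have -> : L * (d%:R * (2 * K_B / n%:R ^+ m)) =
      (L * d%:R * 2 * K_B) * (n%:R ^+ m)^-1 by ring.
    rewrite (le_trans (ler_wpM2l A0 nd))// mulrCA ler_wpM2l ?(ltW d0)//.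
    by rewrite ler_pdivrMr c0E; lra.
  by rewrite mulrDr h1; lra.
have {}SG : covers (sup_dist d) (Gclass d m B) delta S.
  split=> [|g /SG.2[h hS gh]]; first exact: SG.1.
  by exists h => //; rewrite (le_trans gh)// lee_fin.
apply: (metric_entropy_le SG).
have powE : (size S)%:R <= expR ((n * m)%:R ^+ d * (M * e `^ (- tau) + 1)).
  rewrite -natrX expRM_natl (@le_trans _ _ ((size s)%:R ^+ ((n * m) ^ d)%N))//.
    by rewrite -natrX ler_nat.
  by rewrite lerXn2r ?nnegrE ?expR_ge0.
rewrite (le_trans powE)// ler_expR.
have taupos : 1 <= delta `^ (- tau) by exact: pow1.
have eE : e `^ (- tau) = (4 * L) `^ tau * delta `^ (- tau).
  rewrite /e powRM ?(ltW d0) ?invr_ge0 ?mulr_ge0 ?(ltW L0)// mulrC; congr (_ * _).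
  rewrite -powR_inv1 ?mulr_ge0 ?(ltW L0)// -powRrM; congr (_ `^ _).
  by rewrite mulN1r opprK.
rewrite opprD powRD; last by rewrite (gt_eqF d0) implybT.
rewrite -ad mulrACA; apply: ler_pM.
- by rewrite exprn_ge0.
- by rewrite addr_ge0// mulr_ge0 ?powR_ge0// ltW.
- rewrite -exprMn lerXn2r ?nnegrE//.
    by rewrite !mulr_ge0//; lra.
  by rewrite natrM mulrAC ler_wpM2r.
(* The additive 1 from extracting the net is absorbed because [delta ^ (-tau) >= 1] for
   [delta < 1]. *)
- by rewrite eE [leRHS]mulrDl mul1r -mulrA lerD2l.
Qed.
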